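(* Let $C$ be a $\mathbb{B}$-convex compact subset of $\mathbb{R}^n$. There exists a sequence $\{A_m\}_{m\in\mathbb{N}}$ of finite subsets of $C$, with $A_m\subset A_{m+1}$ for every positive integer $m$, such that $$\mathrm{Lim}_{m\to\infty}\,Co^\infty(A_m)=C.$$
   Context: Notation: $\mathbb{N}=\{0,1,2,\dots\}$. For $p\in\mathbb{N}$ let $\varphi_p(\lambda)=\lambda^{2p+1}$, a bijection of $\mathbb{R}$, and let $\phi_p:\mathbb{R}^n\to\mathbb{R}^n$ be its componentwise version. For a finite set $A\subset\mathbb{R}^n$, $Co^p(A)=\phi_p^{-1}\big(Co(\phi_p(A))\big)$, where $Co$ is the usual convex hull (so $Co^p(\emptyset)=\emptyset$). For a sequence of sets $S^{(m)}\subset\mathbb{R}^n$, $\mathrm{Ls}_{m\to\infty}S^{(m)}$ is the set of limits of convergent sequences $x^{(m_k)}\in S^{(m_k)}$ along subsequences $(m_k)$; $\mathrm{Li}_{m\to\infty}S^{(m)}$ is the set of points $x=\lim x^{(m)}$ with $x^{(m)}\in S^{(m)}$ for all $m$; and $\mathrm{Lim}_{m\to\infty}S^{(m)}=S$ means $\mathrm{Ls}_{m\to\infty}S^{(m)}=S=\mathrm{Li}_{m\to\infty}S^{(m)}$ (Painlevé–Kuratowski convergence). Define $Co^\infty(A)=\mathrm{Ls}_{p\to\infty}Co^p(A)$. A set $C\subset\mathbb{R}^n$ is $\mathbb{B}$-convex when $Co^\infty(A)\subset C$ for every finite subset $A$ of $C$. *)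

(* Defs.v *)
From mathcomp Require Import all_boot all_order all_algebra.
From mathcomp Require Import all_classical all_reals all_analysis.

Set Implicit Arguments.
Unset Strict Implicit.
Unset Printing Implicit Defensive.

Import Order.TTheory GRing.Theory Num.Theory.
Import numFieldNormedType.Exports.

Local Open Scope classical_set_scope.
Local Open Scope ring_scope.

Definition conv_hull (R : numDomainType) (E : lmodType R) (A : set E) : set E :=
  smallest (@convex_set R E) A.

(** Painlevé–Kuratowski limits of a sequence of subsets of a topological
    space. *)
Section set_limits.
Variable T : topologicalType.
Implicit Types (S : nat -> set T) (C : set T).

Definition Ls S : set T :=
  [set x | exists (k : nat -> nat) (u : nat -> T),
    [/\ increasing_seq k, forall j, S (k j) (u j) & u j @[j --> \oo] --> x]].

(** The approximating sequence has a term in every [S m], not only in all but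
    finitely many, so [Li S] is empty as soon as one [S m] is. *)
Definition Li S : set T :=
  [set x | exists u : nat -> T,
    (forall m, S m (u m)) /\ u m @[m --> \oo] --> x].

Definition Lim_is S C : Prop := Ls S = C /\ Li S = C.

End set_limits.

Section B_convexity.
Variables (R : realType) (n : nat).
Implicit Types (p : nat) (A C : set 'rV[R]_n).

Definition varphi p (x : R) : R := x ^+ (2 * p + 1).

Definition phi p (x : 'rV[R]_n) : 'rV[R]_n := map_mx (varphi p) x.

(** Since [phi p] is bijective, the preimage below is also the image of the
    hull under the inverse of [phi p]. *)
Definition Co p A : set 'rV[R]_n := phi p @^-1` conv_hull (phi p @` A).

Definition Co_infty A : set 'rV[R]_n := Ls (fun p => Co p A).

Definition B_convex C : Prop :=
  forall A, finite_set A -> A `<=` C -> Co_infty A `<=` C.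

End B_convexity.

(* Main.v *)
Require Import Defs.
From mathcomp Require Import all_boot all_order all_algebra finmap.
From mathcomp Require Import all_classical all_reals all_analysis.

(** Every finite set [A] is contained in [Co_infty A], because it is contained
    in each [Co p A]; and [Co_infty A] stays inside [C] as soon as [A] does, by
    B-convexity. So [Co_infty (A m)] is squeezed between [A m] and [C], and it
    suffices that the finite sets [A m] fill up [C]. Compactness provides a
    finite [1/(m+1)]-net of [C] inside [C] for each [m]
    ([compact_finite_net]); the union of the first [m+1] nets is an increasing
    choice of [A m]. Every point of [C] is then a limit of points of [A m], so
    the lower limit contains [C], while the upper limit stays in [C] because
    [C] is closed; and the lower limit is contained in the upper one. *)

Set Implicit Arguments.
Unset Strict Implicit.
Unset Printing Implicit Defensive.

Import Order.TTheory GRing.Theory Num.Theory.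
Import numFieldNormedType.Exports.

Local Open Scope classical_set_scope.
Local Open Scope ring_scope.

Lemma subset_Co (R : realType) (n p : nat) (A : set 'rV[R]_n) : A `<=` Co p A.
Proof. by move=> x Ax D [_ AD]; apply: AD; exists x. Qed.

Lemma Li_sub_Ls (T : topologicalType) (S : nat -> set T) : Li S `<=` Ls S.
Proof. by move=> x [u [Su ux]]; exists id, u. Qed.

Lemma subset_Co_infty (R : realType) (n : nat) (A : set 'rV[R]_n) :
  A `<=` Co_infty A.
Proof.
move=> x Ax; apply: Li_sub_Ls; exists (fun=> x).
by split; [move=> p; exact: subset_Co | exact: cvg_cst].
Qed.

Lemma Ls_sub_closed (T : topologicalType) (S : nat -> set T) (C : set T) :
  closed C -> (forall m, S m `<=` C) -> Ls S `<=` C.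
Proof.
move=> clC SC x [k [u [_ Su ux]]].
by apply: (closed_cvg C clC _ x ux); apply: nearW => j; exact: SC (Su j).
Qed.

Lemma Li_mono (T : topologicalType) (S S' : nat -> set T) :
  (forall m, S m `<=` S' m) -> Li S `<=` Li S'.
Proof. by move=> SS' x [u [Su ux]]; exists u; split=> // m; exact: SS'. Qed.

(** The balls centred at the points of the compact set cover it; a finite
    subcover gives the centres. *)
Lemma compact_finite_net (R : realType) (V : normedModType R) (C : set V)
    (e : R) : compact C -> 0 < e ->
  exists D : set V,
    [/\ finite_set D, D `<=` C & forall x, C x -> exists2 y, D y & ball x e y].
Proof.
rewrite compact_cover => C_cover e0.
have [|x Cx|D DC CD] := C_cover V C (fun x => ball x e).
- by move=> x _; exact: ball_open.
- by exists x => //; exact: ballxx.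
exists [set` D]; split.
- exact: finite_fset.
- by move=> y /= /DC; rewrite inE.
- by move=> x /CD[y Dy /ball_sym xy]; exists y.
Qed.

(** Choosing, for a given point, a nearby point of each net [S m] yields a
    sequence that converges to it, because the scales [1/(m+1)] tend to 0. *)
Lemma Li_nets (R : realType) (V : normedModType R) (C : set V)
    (S : nat -> set V) :
  (forall m x, C x -> exists2 y, S m y & ball x m.+1%:R^-1 y) -> C `<=` Li S.
Proof.
move=> net x Cx; have /choice[u Su] m : exists y, S m y /\ ball x m.+1%:R^-1 y.
  by have [y] := net m x Cx; exists y.
exists u; split=> [m|]; first exact: (Su m).1.
apply/cvgrPdist_lt => e e0; near=> m.
have := (Su m).2; rewrite -ball_normE /= => /lt_trans; apply.
by near: m; exact: (near_infty_natSinv_lt (PosNum e0)).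
Unshelve. all: by end_near. Qed.

Theorem lemma4p2p3 (R : realType) (n : nat) (C : set 'rV[R]_n)
    (C_Bconvex : B_convex C) (C_compact : compact C) :
  exists A : nat -> set 'rV[R]_n,
    [/\ forall m, finite_set (A m),
        forall m, A m `<=` C,
        forall m, (0 < m)%N -> A m `<=` A m.+1
      & Lim_is (fun m => Co_infty (A m)) C].
Proof.
have /choice[D D_net] m :
    exists D : set 'rV[R]_n, [/\ finite_set D, D `<=` C &
      forall x, C x -> exists2 y, D y & ball x (m.+1%:R^-1 : R) y].
  by apply: compact_finite_net; rewrite // invr_gt0 ltr0n.
pose A m := \bigcup_(i in `I_m.+1) D i.
have A_fin m : finite_set (A m).
  by apply: bigcup_finite => [|i _]; [exact: finite_II | have [] := D_net i].
have AC m : A m `<=` C by move=> x [i _]; have [_ DC _] := D_net i; exact: DC.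
exists A; split=> // [m _ x [i im Dx]|].
  by exists i => //; exact: leqW.
have C_Li : C `<=` Li (fun m => Co_infty (A m)).
  apply: subset_trans (Li_mono (fun m => @subset_Co_infty _ _ (A m))).
  apply: Li_nets => m x Cx; have [_ _ /(_ x Cx)[y Dy xy]] := D_net m.
  by exists y => //; exists m => //=.
have Ls_C : Ls (fun m => Co_infty (A m)) `<=` C.
  apply: Ls_sub_closed => [|m]; last exact: C_Bconvex.
  exact: compact_closed (@norm_hausdorff _ _) C_compact.
split; apply/seteqP; split=> //.
- exact: subset_trans C_Li (@Li_sub_Ls _ _).
- exact: subset_trans (@Li_sub_Ls _ _) Ls_C.
Qed.
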